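(* Let $Q$ be a quiver. A linear double bracket on $\mathbb{C}Q$ determined by $$P_{lin} := \sum_{\substack{a,b,c\in Q_1\\ a\frac{\partial}{\partial b}\frac{\partial}{\partial c}\neq 0\in\mathfrak{n}_Q}} c^a_{bc}\,a\frac{\partial}{\partial b}\frac{\partial}{\partial c}\qquad(c^a_{bc}\in\mathbb{C})$$ is a double Poisson bracket if and only if for all $p,q,r,s\in Q_1$ such that $p\frac{\partial}{\partial q}\frac{\partial}{\partial r}\frac{\partial}{\partial s}\neq 0$ in $\mathfrak{n}_Q$ we have $$\sum_{x\in Q_1^{(p,q,rs)}}c_{rs}^x\,c_{qx}^p - \sum_{y\in Q_1^{(qr,p,s)}}c_{ys}^p\,c_{qr}^y=0,$$ where $$Q_1^{(p,q,rs)} = \Big\{a\in Q_1 \;\Big|\; a\tfrac{\partial}{\partial r}\tfrac{\partial}{\partial s}\neq0 \text{ and } p\tfrac{\partial}{\partial q}\tfrac{\partial}{\partial a} \neq 0 \text{ in } \mathfrak{n}_Q\Big\}$$ and $$Q_1^{(qr,p,s)} = \Big\{a\in Q_1 \;\Big|\; a\tfrac{\partial}{\partial q}\tfrac{\partial}{\partial r}\neq0 \text{ and } p\tfrac{\partial}{\partial a}\tfrac{\partial}{\partial s} \neq 0 \text{ in } \mathfrak{n}_Q\Big\}.$$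
   Context: $\mathbb{C}$ is an algebraically closed field of characteristic $0$; $Q$ is a finite quiver with arrows $Q_1$; $t(a)$, $h(a)$ are tail and head; paths are multiplied so that $a=e_{t(a)}ae_{h(a)}$. Let $A=\mathbb{C}Q$. The outer bimodule structure on $A\otimes A$ is $a.(a'\otimes a'').b=aa'\otimes a''b$. A double bracket on $A$ is a linear map $\{\!\!\{-,-\}\!\!\}:A\otimes A\to A\otimes A$, derivation in its second argument for the outer structure, with $\{\!\!\{a,b\}\!\!\}=-\{\!\!\{b,a\}\!\!\}^o$, $(u\otimes v)^o=v\otimes u$. With Sweedler notation it is a double Poisson bracket if for all $a,b,c$ $$\{\!\!\{a,\{\!\!\{b,c\}\!\!\}'\}\!\!\}\otimes\{\!\!\{b,c\}\!\!\}''+\{\!\!\{c,a\}\!\!\}''\otimes\{\!\!\{b,\{\!\!\{c,a\}\!\!\}'\}\!\!\}+\{\!\!\{c,\{\!\!\{a,b\}\!\!\}'\}\!\!\}''\otimes\{\!\!\{a,b\}\!\!\}''\otimes\{\!\!\{c,\{\!\!\{a,b\}\!\!\}'\}\!\!\}'=0.$$ For $a\in Q_1$, $\frac{\partial}{\partial a}:A\to A\otimes A$ is the derivation (outer structure), vanishing on vertex idempotents, with $\frac{\partial}{\partial a}(a)=e_{t(a)}\otimes e_{h(a)}$ and $\frac{\partial}{\partial a}(b)=0$ for arrows $b\ne a$. Double derivations form an $A$-bimodule by $(a\delta b)(c)=\delta(c)'b\otimes a\delta(c)''$. A product $\delta\Delta$ of double derivations determines the double bracket $\{\!\!\{a,b\}\!\!\}_{\delta\Delta}=(\delta(a)'\Delta\delta(a)'')(b)-(\Delta(a)'\delta\Delta(a)'')(b)$,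 extended linearly; this is how $P_{lin}$ determines a double bracket. The double quiver $\overline{Q}$ is obtained from $Q$ by adding for each $a\in Q_1$ an arrow $a^*$ from $h(a)$ to $t(a)$; $\frac{\partial}{\partial a}$ is identified with $a^*$. Grade $\mathbb{C}\overline{Q}$ by $|a|=0$, $|a^*|=1$; $\mathfrak{n}_Q=\mathbb{C}\overline{Q}/[\mathbb{C}\overline{Q},\mathbb{C}\overline{Q}]_{super}$ is the quotient by the span of supercommutators $uv-(-1)^{|u||v|}vu$. Thus $a\frac{\partial}{\partial b}\frac{\partial}{\partial c}\ne0$ in $\mathfrak{n}_Q$ means that $ab^*c^*$ is a closed path in $\overline{Q}$, and similarly for $p\frac{\partial}{\partial q}\frac{\partial}{\partial r}\frac{\partial}{\partial s}$. *)

(* Defs.v *)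
From HB Require Import structures.
From mathcomp Require Import all_boot all_algebra.
From mathcomp Require Import finmap boolp.
From mathcomp.multinomials Require Import monalg.

Set Implicit Arguments.
Unset Strict Implicit.
Unset Printing Implicit Defensive.

Import GRing.Theory.

Local Open Scope ring_scope.

(* Linear extension of a map defined on the basis [K] of the free module
   [{malg k[K]}]. *)
HB.lock Definition lext (k : fieldType) (K : choiceType) (M : lmodType k)
    (f : K -> M) (x : {malg k[K]}) : M :=
  \sum_(i <- msupp x) x@_i *: f i.

HB.lock Definition basis_elt (k : fieldType) (K : choiceType) (i : K) :
  {malg k[K]} := << i >>.

Section LextTheory.
Variables (k : fieldType) (K : choiceType) (M : lmodType k).
Implicit Types (f g : K -> M) (x y : {malg k[K]}).

Lemma lextw f x (d : {fset K}) : (msupp x `<=` d)%fset ->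
  lext f x = \sum_(i <- d) x@_i *: f i.
Proof.
move=> le_xd; rewrite lext.unlock; apply: big_fset_incl => // i _ /mcoeff_outdom ->.
by rewrite scale0r.
Qed.

Lemma lext_is_linear f : linear (lext f).
Proof.
move=> c x y; set d := (msupp x `|` msupp y)%fset.
have sx : (msupp x `<=` d)%fset by apply: fsubsetUl.
have sy : (msupp y `<=` d)%fset by apply: fsubsetUr.
have sxy : (msupp (c *: x + y) `<=` d)%fset.
  apply: (fsubset_trans (msuppD_le _ _)); apply: fsetSU; exact: msuppZ_le.
rewrite (lextw _ sx) (lextw _ sy) (lextw _ sxy) scaler_sumr -big_split /=.
by apply: eq_bigr => i _; rewrite mcoeffD mcoeffZ scalerDl scalerA.
Qed.

HB.instance Definition _ f :=
  GRing.isLinear.Build k {malg k[K]} M *:%R (lext f) (lext_is_linear f).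

Lemma lextU f i : lext f (basis_elt k i) = f i.
Proof. by rewrite lext.unlock basis_elt.unlock msuppU oner_eq0 big_seq_fset1 mcoeffUU scale1r. Qed.

Lemma malg_lin_ext (f g : {linear {malg k[K]} -> M}) :
  (forall i, f (basis_elt k i) = g (basis_elt k i)) -> f =1 g.
Proof.
move=> fg x; rewrite [x]monalgE !linear_sum; apply: eq_bigr => i _.
have -> : << x@_i *g i >> = x@_i *: basis_elt k i.
  by rewrite basis_elt.unlock; apply/malgP => j; rewrite mcoeffZ !mcoeffU mulrnAr mulr1.
by rewrite !linearZ /= fg.
Qed.

Lemma lext_linf (V : lmodType k) (F : V -> K -> M) x :
  (forall i, linear (F^~ i)) -> linear (fun v => lext (F v) x).
Proof.
move=> lF c u v; rewrite lext.unlock scaler_sumr -big_split /=; apply: eq_bigr => i _.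
by rewrite lF scalerDr !scalerA mulrC.
Qed.

Lemma lin0 (V : lmodType k) (f : V -> M) : linear f -> f 0 = 0.
Proof. by move=> lf; have := lf (-1) 0 0; rewrite addr0 scaler0 scaleN1r addNr. Qed.

Lemma linZ (V : lmodType k) (f : V -> M) : linear f -> scalable f.
Proof. by move=> lf c u; have := lf c u 0; rewrite !addr0 (lin0 lf) addr0. Qed.

Lemma linD (V : lmodType k) (f : V -> M) :
  linear f -> {morph f : u v / u + v}.
Proof. by move=> lf u v; have := lf 1 u v; rewrite !scale1r. Qed.

End LextTheory.

Record quiver := Quiver {
  vertex : finType;
  arrow : finType;
  tail : arrow -> vertex;
  head : arrow -> vertex
}.

Arguments tail {q} _.
Arguments head {q} _.

Section Paths.
Variable Q : quiver.

Fixpoint is_path (v : vertex Q) (s : seq (arrow Q)) : bool :=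
  if s is a :: s' then (tail a == v) && is_path (head a) s' else true.

(* A path is its start vertex together with its arrows read from left to
   right; the empty word at [v] is the trivial path at [v]. *)
Record qpath := QPath {
  path_val : vertex Q * seq (arrow Q);
  path_valP : is_path path_val.1 path_val.2
}.

HB.instance Definition _ := [isSub for path_val].
HB.instance Definition _ := [Choice of qpath by <:].

Definition source (p : qpath) : vertex Q := (path_val p).1.
Definition arrows (p : qpath) : seq (arrow Q) := (path_val p).2.
Definition target (p : qpath) : vertex Q :=
  last (source p) [seq head a | a <- arrows p].

Definition trivial_path (v : vertex Q) : qpath :=
  @QPath (v, [::]) isT.

Lemma arrow_path_subproof (a : arrow Q) : is_path (tail a) [:: a].
Proof. by rewrite /= eqxx. Qed.

Definition arrow_path (a : arrow Q) : qpath :=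
  @QPath (tail a, [:: a]) (arrow_path_subproof a).

Lemma is_path_cat v s t :
  is_path v (s ++ t) =
  is_path v s && is_path (last v [seq head a | a <- s]) t.
Proof. by elim: s v => //= a s IHs v; rewrite IHs andbA. Qed.

Lemma path_cat_subproof (p q : qpath) :
  target p == source q -> is_path (source p) (arrows p ++ arrows q).
Proof.
by move/eqP=> pq; rewrite is_path_cat [is_path _ _]path_valP /= -/(target p)
  pq [is_path _ _]path_valP.
Qed.

Definition path_cat (p q : qpath) : option qpath :=
  match boolP (target p == source q) with
  | AltTrue pq =>
      Some (@QPath (source p, arrows p ++ arrows q) (path_cat_subproof pq))
  | AltFalse _ => None
  end.

Variant path_cat_spec (p q : qpath) : option qpath -> Type :=
| PathCatSome r of target p = source q & source r = source p
    & target r = target q & arrows r = arrows p ++ arrows q :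
    path_cat_spec p q (Some r)
| PathCatNone of target p != source q : path_cat_spec p q None.

Lemma path_catP p q : path_cat_spec p q (path_cat p q).
Proof.
rewrite /path_cat; case: {-}_ / boolP => [pq | npq]; last exact: PathCatNone.
apply: PathCatSome => //; first exact/eqP.
rewrite {1}/target /source /arrows /= map_cat last_cat -/(source p).
by rewrite -/(target p) (eqP pq).
Qed.

Lemma qpath_inj p q : source p = source q -> arrows p = arrows q -> p = q.
Proof.
move=> e1 e2; apply: val_inj; move: e1 e2; rewrite /source /arrows /=.
by case: (path_val p) (path_val q) => [? ?] [? ?] /= -> ->.
Qed.

End Paths.

Definition path_algebra (k : fieldType) (Q : quiver) := {malg k[qpath Q]}.

Section Basis.
Variables (k : fieldType) (Q : quiver).

HB.instance Definition _ := GRing.Lmodule.on (path_algebra k Q).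

Local Notation A := (path_algebra k Q).

Definition of_path (p : qpath Q) : A := basis_elt k p.

Definition idem (v : vertex Q) : A := of_path (trivial_path v).
Definition arr (a : arrow Q) : A := of_path (arrow_path a).

Definition path_mul (p q : qpath Q) : A := oapp of_path 0 (path_cat p q).

End Basis.

HB.lock Definition pa_mul (k : fieldType) (Q : quiver)
    (x y : path_algebra k Q) : path_algebra k Q :=
  lext (fun p => lext (fun q => path_mul k p q) y) x.

Arguments pa_mul {k Q} x y.

Section PathAlgebra.
Variables (k : fieldType) (Q : quiver).

Local Notation A := (path_algebra k Q).
Local Notation of_path := (@of_path k Q).
Local Notation idem := (@idem k Q).
Local Notation path_mul := (@path_mul k Q).

Definition pa_one : A := \sum_v idem v.

Lemma pa_mulUU p q : pa_mul (of_path p) (of_path q) = path_mul p q.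
Proof. by rewrite pa_mul.unlock !lextU. Qed.

Lemma pa_mul_linl (y : A) : linear (pa_mul^~ y).
Proof. by move=> c x x'; rewrite pa_mul.unlock linearP. Qed.

Lemma pa_mul_linr (x : A) : linear (pa_mul x).
Proof.
move=> c y y'; rewrite pa_mul.unlock.
apply: (lext_linf (F := fun y p => lext (path_mul p) y)) => p d u v.
by rewrite linearP.
Qed.

Lemma pa_mulDl : left_distributive (@pa_mul k Q) +%R.
Proof. by move=> x x' y; apply: (linD (pa_mul_linl y)). Qed.

Lemma pa_mulDr : right_distributive (@pa_mul k Q) +%R.
Proof. by move=> x; apply: (linD (pa_mul_linr x)). Qed.

Lemma pa_mul0l (x : A) : pa_mul 0 x = 0.
Proof. exact: (lin0 (pa_mul_linl x)). Qed.

Lemma pa_mul0r (x : A) : pa_mul x 0 = 0.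
Proof. exact: (lin0 (pa_mul_linr x)). Qed.

Lemma pa_lin_ext (M : lmodType k) (f g : A -> M) :
  linear f -> linear g ->
  (forall p, f (of_path p) = g (of_path p)) -> f =1 g.
Proof.
move=> lf lg.
pose F : {linear {malg k[qpath Q]} -> M} := HB.pack f
  (GRing.isLinear.Build k {malg k[qpath Q]} M *:%R f lf).
pose G : {linear {malg k[qpath Q]} -> M} := HB.pack g
  (GRing.isLinear.Build k {malg k[qpath Q]} M *:%R g lg).
exact: (@malg_lin_ext _ _ _ F G).
Qed.

Lemma pa_mulA : associative (@pa_mul k Q).
Proof.
move=> x y z; move: x; apply: pa_lin_ext.
- by move=> c u v; rewrite pa_mul_linl.
- by move=> c u v; rewrite 2!pa_mul_linl.
move=> p; move: y; apply: pa_lin_ext.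
- by move=> c u v; rewrite pa_mul_linl pa_mul_linr.
- by move=> c u v; rewrite pa_mul_linr pa_mul_linl.
move=> q; move: z; apply: pa_lin_ext.
- by move=> c u v; rewrite 2!pa_mul_linr.
- by move=> c u v; rewrite pa_mul_linr.
move=> r; rewrite !pa_mulUU /path_mul.
case: (path_catP q r) => [qr e1 e2 e3 e4|n1] /=;
  case: (path_catP p q) => [pq f1 f2 f3 f4|n2] /=;
  rewrite ?pa_mul0r ?pa_mul0l ?pa_mulUU /path_mul //.
- case: path_catP => [u g1 g2 g3 g4|]; last by rewrite e2 f1 eqxx.
  case: path_catP => [v h1 h2 h3 h4|]; last by rewrite f3 e1 eqxx.
  congr of_path; apply: qpath_inj; first by rewrite g2 h2 f2.
  by rewrite g4 h4 e4 f4 catA.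
- by case: path_catP => // u g1; rewrite g1 e2 eqxx in n2.
- by case: path_catP => // u; rewrite f3 => g1; rewrite g1 eqxx in n1.
Qed.

Lemma pa_mul_ep v p : pa_mul (idem v) (of_path p) =
  if v == source p then of_path p else 0.
Proof.
rewrite pa_mulUU /path_mul; case: path_catP => [r|].
  move=> ev e1 _ e2; have {}ev : v = source p := ev.
  rewrite ev eqxx; congr of_path.
  by apply: qpath_inj; rewrite ?e1 ?e2.
by rewrite [target _ == _]/(v == _) => /negbTE ->.
Qed.

Lemma pa_mul_pe v p : pa_mul (of_path p) (idem v) =
  if target p == v then of_path p else 0.
Proof.
rewrite pa_mulUU /path_mul; case: path_catP => [r|].
  move=> -> e1 _ e2; rewrite eqxx; congr of_path.
  by apply: qpath_inj; rewrite ?e2 ?cats0.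
by move=> /negbTE ->.
Qed.

Lemma pa_mul1l : left_id pa_one (@pa_mul k Q).
Proof.
apply: pa_lin_ext => [c u v|//|p]; first by rewrite pa_mul_linr.
rewrite (big_morph (pa_mul^~ (of_path p)) (fun x y => pa_mulDl x y _)
  (pa_mul0l _)).
rewrite (bigD1 (source p)) //= pa_mul_ep eqxx big1 ?addr0 // => v.
by rewrite pa_mul_ep => /negbTE ->.
Qed.

Lemma pa_mul1r : right_id pa_one (@pa_mul k Q).
Proof.
apply: pa_lin_ext => [c u v|//|p]; first by rewrite pa_mul_linl.
rewrite (big_morph (pa_mul (of_path p)) (pa_mulDr _) (pa_mul0r _)).
rewrite (bigD1 (target p)) //= pa_mul_pe eqxx big1 ?addr0 // => v.
by rewrite pa_mul_pe eq_sym => /negbTE ->.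
Qed.

HB.instance Definition _ := GRing.Zmodule_isPzRing.Build A
  pa_mulA pa_mul1l pa_mul1r pa_mulDl pa_mulDr.

Lemma pa_scaleAl c (x y : A) : c *: (x * y) = c *: x * y.
Proof. by rewrite -[RHS]/(pa_mul _ _) (linZ (pa_mul_linl y)). Qed.

Lemma pa_scaleAr c (x y : A) : c *: (x * y) = x * (c *: y).
Proof. by rewrite -[RHS]/(pa_mul _ _) (linZ (pa_mul_linr x)). Qed.

End PathAlgebra.

Arguments idem {k Q} v.
Arguments arr {k Q} a.

(* [A (x) A] and [A (x) A (x) A] as the free modules on pairs and triples of
   paths, for [A] the path algebra. *)
Definition tensor2 (k : fieldType) (Q : quiver) := {malg k[(qpath Q * qpath Q)%type]}.
Definition tensor3 (k : fieldType) (Q : quiver) :=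
  {malg k[(qpath Q * qpath Q * qpath Q)%type]}.

Section DoubleBrackets.
Variables (k : fieldType) (Q : quiver).

HB.instance Definition _ := GRing.Lmodule.on (tensor2 k Q).
HB.instance Definition _ := GRing.Lmodule.on (tensor3 k Q).

Local Notation A := (path_algebra k Q).
Local Notation of_path := (@of_path k Q).
Local Notation T2 := (tensor2 k Q).
Local Notation T3 := (tensor3 k Q).

Definition tens2 (u v : A) : T2 :=
  lext (fun p => lext (fun q => basis_elt k (p, q) : T2) v) u.

Definition tens3 (u v w : A) : T3 :=
  lext (fun p => lext (fun q => lext (fun r => basis_elt k (p, q, r) : T3) w) v) u.

(* [sweedler f t] is [f t' t''] in Sweedler notation, for [f] bilinear. *)
Definition sweedler (M : lmodType k) (f : A -> A -> M) (t : T2) : M :=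
  lext (fun pq => f (of_path pq.1) (of_path pq.2)) t.

Definition swap (t : T2) : T2 := sweedler (fun u v => tens2 v u) t.

(* [a.t.b] for the outer bimodule structure *)
Definition outer (a : A) (t : T2) (b : A) : T2 :=
  sweedler (fun u v => tens2 (a * u) (v * b)) t.

Definition double_derivation (d : A -> T2) : Prop :=
  linear d /\ forall b c, d (b * c) = outer b (d c) 1 + outer 1 (d b) c.

Definition double_bracket (br : A -> A -> T2) : Prop :=
  [/\ forall b, linear (fun a => br a b),
      forall a, double_derivation (br a)
    & forall a b, br a b = - swap (br b a)].

Definition double_jacobi (br : A -> A -> T2) : Prop :=
  forall a b c : A,
    sweedler (fun u v => sweedler (fun x y => tens3 x y v) (br a u)) (br b c)
  + sweedler (fun u v => sweedler (fun x y => tens3 v x y) (br b u)) (br c a)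
  + sweedler (fun u v => sweedler (fun x y => tens3 y v x) (br c u)) (br a b)
  = 0.

Definition double_poisson (br : A -> A -> T2) : Prop :=
  double_bracket br /\ double_jacobi br.

Definition word (s : seq (arrow Q)) : A := \prod_(y <- s) arr y.

(* [partial a] is computed on a path [x_1 ... x_n] by the Leibniz rule;
   [partialP] characterizes it as the double derivation vanishing on the [e_v]
   and equal to [partial_arrow a] on arrows. *)
Definition partial_arrow (a x : arrow Q) : T2 :=
  if x == a then tens2 (idem (tail a)) (idem (head a)) else 0.

Fixpoint partial_word (a : arrow Q) (s : seq (arrow Q)) : T2 :=
  if s is x :: s' then
    outer (arr x) (partial_word a s') 1
    + outer 1 (partial_arrow a x) (word s')
  else 0.

Definition partial (a : arrow Q) (x : A) : T2 :=
  lext (fun p => partial_word a (arrows p)) x.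

Lemma tens2_linl v : linear (tens2^~ v).
Proof. by move=> c u u'; rewrite /tens2 linearP. Qed.

Lemma tens2_linr u : linear (tens2 u).
Proof.
move=> c v v'; apply: (lext_linf (F := fun v p => lext _ v)) => p d w w'.
by rewrite linearP.
Qed.

Lemma sweedler_lin (M : lmodType k) (f : A -> A -> M) : linear (sweedler f).
Proof. by move=> c t t'; rewrite /sweedler linearP. Qed.

Lemma sweedler_tens2 (M : lmodType k) (f : A -> A -> M) u v :
  (forall v, linear (f^~ v)) -> (forall u, linear (f u)) ->
  sweedler f (tens2 u v) = f u v.
Proof.
move=> fl fr; move: u; apply: pa_lin_ext => [c u u'|//|p].
  by rewrite tens2_linl sweedler_lin.
move: v; apply: pa_lin_ext => [c v v'|//|q].
  by rewrite tens2_linr sweedler_lin.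
by rewrite /tens2 !lextU /sweedler lextU.
Qed.

Lemma outer_lin a b : linear (fun t => outer a t b).
Proof. exact: sweedler_lin. Qed.

Lemma outer_tens2 a b u v : outer a (tens2 u v) b = tens2 (a * u) (v * b).
Proof.
by rewrite /outer sweedler_tens2 // => [w|w] c x y;
  rewrite ?mulrDr ?mulrDl -?pa_scaleAr -?pa_scaleAl ?tens2_linl ?tens2_linr.
Qed.

Lemma outer_linl t b : linear (fun a => outer a t b).
Proof.
pose F (a : A) (pq : qpath Q * qpath Q) :=
  tens2 (a * of_path pq.1) (of_path pq.2 * b).
move=> l x0 y0; apply: (@lext_linf k _ _ A F t _ l x0 y0) => pq c x y; rewrite /F.
by rewrite mulrDl -pa_scaleAl tens2_linl.
Qed.

Lemma outer_linr a t : linear (outer a t).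
Proof.
pose F (b : A) (pq : qpath Q * qpath Q) :=
  tens2 (a * of_path pq.1) (of_path pq.2 * b).
move=> l x0 y0; apply: (@lext_linf k _ _ A F t _ l x0 y0) => pq c x y; rewrite /F.
by rewrite mulrDr -pa_scaleAr tens2_linr.
Qed.

Lemma outerD a b t t' : outer a (t + t') b = outer a t b + outer a t' b.
Proof. exact: (linD (outer_lin a b)). Qed.

Lemma outer0 a b : outer a 0 b = 0.
Proof. exact: (lin0 (outer_lin a b)). Qed.

Lemma outer0l t b : outer 0 t b = 0.
Proof. exact: (lin0 (outer_linl t b)). Qed.

Lemma outer0r a t : outer a t 0 = 0.
Proof. exact: (lin0 (outer_linr a t)). Qed.

Lemma tens2_ext (M : lmodType k) (f g : T2 -> M) :
  linear f -> linear g -> (forall u v, f (tens2 u v) = g (tens2 u v)) ->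
  f =1 g.
Proof.
move=> lf lg fg.
pose F : {linear {malg k[(qpath Q * qpath Q)%type]} -> M} := HB.pack f
  (GRing.isLinear.Build k {malg k[(qpath Q * qpath Q)%type]} M *:%R f lf).
pose G : {linear {malg k[(qpath Q * qpath Q)%type]} -> M} := HB.pack g
  (GRing.isLinear.Build k {malg k[(qpath Q * qpath Q)%type]} M *:%R g lg).
apply: (@malg_lin_ext _ _ _ F G) => -[p q] /=.
by have := fg (of_path p) (of_path q); rewrite /tens2 !lextU.
Qed.

Lemma outerA a a' b b' t :
  outer a (outer a' t b') b = outer (a * a') t (b' * b).
Proof.
move: t; apply: tens2_ext => [c x y|c x y|u v]; rewrite ?outer_lin //.
by rewrite !outer_tens2 !mulrA.
Qed.

Lemma outer1 t : outer 1 t 1 = t.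
Proof.
move: t; apply: (tens2_ext (g := id)) => [c x y|//|u v]; rewrite ?outer_lin //.
by rewrite outer_tens2 mul1r mulr1.
Qed.

Lemma idem_idem v : idem v * idem v = idem v :> A.
Proof. by have := pa_mul_ep k v (trivial_path v); rewrite eqxx. Qed.

Lemma idem_path p : idem (source p) * of_path p = of_path p.
Proof. by have := pa_mul_ep k (source p) p; rewrite eqxx. Qed.

Lemma path_idem p : of_path p * idem (target p) = of_path p.
Proof. by have := pa_mul_pe k (target p) p; rewrite eqxx. Qed.

Lemma idem_arr a : idem (tail a) * arr a = arr a :> A.
Proof. exact: (idem_path (arrow_path a)). Qed.

Lemma arr_idem a : arr a * idem (head a) = arr a :> A.
Proof. exact: (path_idem (arrow_path a)). Qed.

Lemma pathE p : of_path p = idem (source p) * word (arrows p).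
Proof.
case: p => -[v s] vs; rewrite /source /arrows /=.
elim: s v vs => [|a s IHs] v vs.
  by rewrite /word big_nil mulr1; congr of_path; apply: qpath_inj.
have /andP[/eqP av hs] := vs; have {}av : tail a = v := av.
rewrite /word big_cons -/(word s).
have -> : idem v * (arr a * word s) = arr a * (idem (head a) * word s).
  by rewrite !mulrA arr_idem -av idem_arr.
rewrite -(IHs (head a) hs).
rewrite -[_ * _]/(pa_mul _ _) pa_mulUU /path_mul.
case: path_catP => [r _ e1 _ e2|]; last by rewrite eqxx.
by congr of_path; apply: qpath_inj; rewrite ?e1 ?e2 //; apply/esym.
Qed.

Lemma word_idem v s : is_path v s ->
  idem v * word s * idem (last v [seq head a | a <- s]) = idem v * word s.
Proof. by move=> vs; have := path_idem (QPath (path_val := (v, s)) vs);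
  rewrite pathE. Qed.

Lemma partial_wordl a v s : is_path v s ->
  outer (idem v) (partial_word a s) 1 = partial_word a s.
Proof.
case: s => [|x s] /=; first by rewrite outer0.
move=> /andP[/eqP xv _]; rewrite outerD !outerA -xv idem_arr mulr1; congr (_ + _).
rewrite /partial_arrow; case: eqP => [->|]; last by rewrite !outer0.
by rewrite !outer_tens2 !mulr1 mul1r idem_idem.
Qed.

Lemma partial_wordr a v s : is_path v s ->
  outer 1 (partial_word a s) (idem (last v [seq head a | a <- s]))
    = partial_word a s.
Proof.
elim: s v => [|x s IHs] v /=; first by rewrite outer0.
move=> /andP[/eqP xv xs]; rewrite outerD !outerA !mul1r; congr (_ + _).
  by rewrite -{2}(IHs _ xs) outerA !mulr1.
rewrite /partial_arrow; case: eqP => [xa|]; last by rewrite !outer0.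
by rewrite -xa !outer_tens2 mulrA word_idem.
Qed.

Lemma partial_word_cat a s t : partial_word a (s ++ t) =
  outer (word s) (partial_word a t) 1 + outer 1 (partial_word a s) (word t).
Proof.
elim: s => [|x s IHs] /=; first by rewrite /word big_nil outer1 outer0 addr0.
rewrite IHs !outerD !outerA !mulr1 !mul1r /word !big_cons big_cat /=.
by rewrite addrA.
Qed.

Lemma partialU a p : partial a (of_path p) = partial_word a (arrows p).
Proof. by rewrite /partial lextU. Qed.

Lemma partial_lin a : linear (partial a).
Proof. by move=> c x y; rewrite /partial linearP. Qed.

Lemma partialM a (b c : A) :
  partial a (b * c) = outer b (partial a c) 1 + outer 1 (partial a b) c.
Proof.
move: b; apply: pa_lin_ext => [l x y|l x y|p].
- by rewrite mulrDl -pa_scaleAl partial_lin.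
- by rewrite partial_lin outer_lin outer_linl scalerDr addrACA.
move: c; apply: pa_lin_ext => [l x y|l x y|q].
- by rewrite mulrDr -pa_scaleAr partial_lin.
- by rewrite partial_lin outer_lin outer_linr scalerDr addrACA.
have pl := partial_wordl a (path_valP q).
have pr := partial_wordr a (path_valP p).
rewrite !partialU -[_ * _]/(pa_mul _ _) pa_mulUU /path_mul.
have el : outer (of_path p) (partial_word a (arrows q)) 1 =
    outer (of_path p * idem (source q)) (partial_word a (arrows q)) 1.
  by rewrite -{1}pl outerA mulr1.
have er : outer 1 (partial_word a (arrows p)) (of_path q) =
    outer 1 (partial_word a (arrows p)) (idem (target p) * of_path q).
  by rewrite -{1}pr outerA mulr1.
case: path_catP => [r pq _ _ e|/negbTE npq] /=; last first.
  rewrite el er -![_ * _]/(pa_mul _ _) pa_mul_pe pa_mul_ep npq.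
  by rewrite outer0l outer0r addr0 /partial lext.unlock msupp0 big_seq_fset0.
rewrite partialU e partial_word_cat; congr (_ + _).
- rewrite pathE; move: pq; rewrite /target /word.
  case: (arrows p) (valP p : is_path (source p) (arrows p)) => [|x s] /=.
    by rewrite big_nil => _ ->; rewrite mulr1 outer1 pl.
  by move=> /andP[/eqP <- _] _; rewrite big_cons mulrA idem_arr.
- rewrite pathE; move: pr; rewrite -/(target p) pq => pr.
  by rewrite -{1}pr outerA mulr1.
Qed.

Lemma partial_idem a v : partial a (idem v) = 0.
Proof. by rewrite partialU. Qed.

Lemma partial_arr a x : partial a (arr x) = partial_arrow a x.
Proof. by rewrite partialU /= outer0 add0r /word big_nil outer1. Qed.

Lemma partialP a (d : A -> T2) :
  [/\ double_derivation d, (forall v, d (idem v) = 0)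
    & forall x, d (arr x) = partial_arrow a x] <-> d =1 partial a.
Proof.
split=> [[[dl dM] d0 da]|dE]; last first.
  split=> [|v|x]; rewrite ?dE ?partial_idem ?partial_arr //.
  by split=> [c x y|b c]; rewrite !dE ?partialM // partial_lin.
apply: pa_lin_ext => [//||p]; first exact: partial_lin.
have d1 : d 1 = 0.
  by apply: (addrI (d 1)); rewrite addr0 -{3}(mulr1 1) dM !outer1.
have p1 : partial a 1 = 0.
  apply: (addrI (partial a 1)).
  by rewrite addr0 -{3}(mulr1 1) partialM !outer1.
rewrite !pathE dM partialM d0 partial_idem !outer0; congr (outer _ _ _ + _).
elim: (arrows p) => [|x s IHs]; first by rewrite /word big_nil d1 p1.
by rewrite /word big_cons -/(word s) dM partialM IHs da partial_arr.
Qed.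

(* The bimodule structure [a d b] on double derivations *)
Definition dder_bimod (a : A) (d : A -> T2) (b : A) (c : A) : T2 :=
  sweedler (fun u v => tens2 (u * b) (a * v)) (d c).

Definition product_bracket (d D : A -> T2) (a b : A) : T2 :=
  sweedler (fun u v => dder_bimod u D v b) (d a)
  - sweedler (fun u v => dder_bimod u d v b) (D a).

End DoubleBrackets.

Definition double_quiver (Q : quiver) : quiver :=
  @Quiver (vertex Q) (arrow Q + arrow Q)%type
    (fun x => match x with inl a => tail a | inr a => head a end)
    (fun x => match x with inl a => head a | inr a => tail a end).

Section LinearBracket.
Variables (k : fieldType) (Q : quiver).

Local Notation B := (path_algebra k (double_quiver Q)).

Definition star_degree (p : qpath (double_quiver Q)) : nat :=
  count (fun x : arrow Q + arrow Q => if x is inr _ then true else false)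
    (arrows p).

Definition homogeneous (d : nat) (u : B) : Prop :=
  forall p, p \in msupp u -> star_degree p = d.

Inductive supercommutators : B -> Prop :=
| supercommutators0 : supercommutators 0
| supercommutatorsD (l : k) (d e : nat) (u v z : B) :
    homogeneous d u -> homogeneous e v -> supercommutators z ->
    supercommutators (l *: (u * v - (-1) ^+ (d * e) *: (v * u)) + z).

(* [u <> 0] in the quotient [n_Q] by the supercommutators *)
Definition nonzero_nQ (u : B) : Prop := ~ supercommutators u.

Definition arrB (a : arrow Q) : B := @arr k (double_quiver Q) (inl a).

(* d/da, identified with the arrow a^* *)
Definition starB (a : arrow Q) : B := @arr k (double_quiver Q) (inr a).

Definition nonzero3 (a b c : arrow Q) : Prop :=
  nonzero_nQ (arrB a * starB b * starB c).

Definition nonzero4 (p q r s : arrow Q) : Prop :=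
  nonzero_nQ (arrB p * starB q * starB r * starB s).

(* [c a b d] is the structure constant with upper index [a] and lower indices
   [b], [d]; only its values with [nonzero3 a b d] are used. *)
Definition lin_bracket (c : arrow Q -> arrow Q -> arrow Q -> k)
    (u v : path_algebra k Q) : tensor2 k Q :=
  \sum_a \sum_b \sum_(d | `[< nonzero3 a b d >])
    c a b d *: product_bracket (dder_bimod (arr a) (partial b) 1) (partial d)
                 u v.

(* Q_1^{(p,q,rs)} *)
Definition arrows_p_q_rs (p q r s : arrow Q) : {set arrow Q} :=
  [set a | `[< nonzero3 a r s /\ nonzero3 p q a >]].

(* Q_1^{(qr,p,s)} *)
Definition arrows_qr_p_s (q r p s : arrow Q) : {set arrow Q} :=
  [set a | `[< nonzero3 a q r /\ nonzero3 p a s >]].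

End LinearBracket.

(* Main.v *)
From HB Require Import structures.
From mathcomp.multinomials Require Import monalg.
From mathcomp Require Import boolp finmap.
Require Import Defs.
From mathcomp Require Import all_boot all_algebra.

(** Read the structure constants as a bilinear product on the span of the
    arrows: [u . v] is the sum of the [c^a_{uv} a], over those [a] for which
    [a u^* v^*] is a closed path of the double quiver.  Evaluating the
    definitions on arrows gives

      [{{u, v}} = u.v (x) e_{t(u)} - e_{t(v)} (x) v.u]

    ([lin_bracket_arr]), the quiver version of the double bracket attached to
    an associative product.  Applying this formula once more, the six terms
    of the double Jacobi expression at arrows [u, v, w] pair up, according to
    the tensor factor that carries an arrow, into

      [as(u,v,w) (x) e_{t(u)} (x) e_{t(v)} + e_{t(w)} (x) as(v,w,u) (x) e_{t(v)}
       + e_{t(w)} (x) e_{t(u)} (x) as(w,u,v)]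

    where [as(u,v,w) = u.(v.w) - (u.v).w] ([jacobiator_arr]).  The three
    summands live in independent parts of the triple tensor product, so the
    expression vanishes on arrows exactly when the product is associative, and
    the coefficient of [p] in [as(q,r,s)] is the quadratic expression of the
    theorem ([associatorE]).

    Three facts turn this computation into a proof.

    - The bracket is a double bracket whatever the constants are
      ([lin_bracket_double]).
    - The double Jacobi expression of a double bracket that kills the vertex
      idempotents vanishes as soon as it vanishes on arrows
      ([double_jacobi_on_arrows]): it is cyclically invariant and it is a
      derivation in its last argument.
    - A product [a b_1^* ... b_n^*] is nonzero modulo supercommutators exactly
      when it is a closed path ([nonzero_nQ_word]).  A path [w] that is not
      closed is the supercommutator of [w] with the idempotent at its end;
      for a closed one, a linear form that vanishes on supercommutators
      detects it.  This makes all side conditions of the theorem explicit, and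
      shows that both sums are empty when [p q^* r^* s^*] is not a closed
      path ([assoc_coef0]). *)

Set Implicit Arguments.
Unset Strict Implicit.
Unset Printing Implicit Defensive.

Import GRing.Theory.
Local Open Scope ring_scope.

(** * Multilinear operations on tensors of paths *)

Section Tensors.
Variables (k : fieldType) (Q : quiver).

Local Notation A := (path_algebra k Q).
Local Notation T2 := (tensor2 k Q).
Local Notation T3 := (tensor3 k Q).

Lemma linN (V M : lmodType k) (f : V -> M) : linear f -> {morph f : u / - u}.
Proof. by move=> lf u; rewrite -scaleN1r (linZ lf) scaleN1r. Qed.

Lemma lin_sum (V M : lmodType k) (f : V -> M) (I : Type) (r : seq I)
    (P : pred I) (F : I -> V) :
  linear f -> f (\sum_(i <- r | P i) F i) = \sum_(i <- r | P i) f (F i).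
Proof. by move=> lf; apply: (big_morph f (linD lf) (lin0 lf)). Qed.

Lemma eq_sweedler (M : lmodType k) (f g : A -> A -> M) :
  (forall u v, f u v = g u v) -> sweedler f =1 sweedler g.
Proof.
by move=> fg t; rewrite /sweedler lext.unlock; apply: eq_bigr => i _; rewrite fg.
Qed.

Lemma lin_sweedler (M N : lmodType k) (g : M -> N) (f : A -> A -> M) t :
  linear g -> g (sweedler f t) = sweedler (fun u v => g (f u v)) t.
Proof.
move=> lg; rewrite /sweedler lext.unlock (lin_sum _ _ _ lg).
by apply: eq_bigr => i _; rewrite (linZ lg).
Qed.

Lemma sweedler_linf (V M : lmodType k) (F : V -> A -> A -> M) t :
  (forall u v, linear (fun z => F z u v)) -> linear (fun z => sweedler (F z) t).
Proof.
move=> lF; apply: (lext_linf (F := fun z pq => F z _ _)) => pq; exact: lF.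
Qed.

Lemma tens3_lin1 v w : linear (fun u : A => tens3 u v w).
Proof. by move=> l x y; rewrite /tens3 linearP. Qed.

Lemma tens3_lin2 u w : linear (fun v : A => tens3 u v w).
Proof.
apply: (lext_linf (F := fun (v : A) p => lext _ v)) => p l x y.
by rewrite linearP.
Qed.

Lemma tens3_lin3 u v : linear (fun w : A => tens3 u v w).
Proof.
apply: (lext_linf (F := fun (w : A) p => lext _ v)) => p.
apply: (lext_linf (F := fun (w : A) q => lext _ w)) => q l x y.
by rewrite linearP.
Qed.

Definition lext3 (M : lmodType k) (f : A -> A -> A -> M) (t : T3) : M :=
  lext (fun pqr => f (of_path k pqr.1.1) (of_path k pqr.1.2) (of_path k pqr.2)) t.

Lemma lext3_lin (M : lmodType k) (f : A -> A -> A -> M) : linear (lext3 f).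
Proof. by move=> l x y; rewrite /lext3 linearP. Qed.

Lemma lext3_tens3 (M : lmodType k) (f : A -> A -> A -> M) u v w :
  (forall v w, linear (fun u => f u v w)) ->
  (forall u w, linear (fun v => f u v w)) ->
  (forall u v, linear (f u v)) ->
  lext3 f (tens3 u v w) = f u v w.
Proof.
move=> l1 l2 l3.
move: u; apply: pa_lin_ext => [l x y|//|p]; first by rewrite tens3_lin1 lext3_lin.
move: v; apply: pa_lin_ext => [l x y|//|q]; first by rewrite tens3_lin2 lext3_lin.
move: w; apply: pa_lin_ext => [l x y|//|r]; first by rewrite tens3_lin3 lext3_lin.
by rewrite /tens3 /of_path !lextU /lext3 lextU.
Qed.

Definition rot3 : T3 -> T3 := lext3 (fun u v w => tens3 w u v).

Lemma rot3_lin : linear rot3.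
Proof. exact: lext3_lin. Qed.

Lemma rot3_tens3 u v w : rot3 (tens3 u v w) = tens3 w u v.
Proof.
apply: lext3_tens3 => ? ?;
  [exact: tens3_lin2 | exact: tens3_lin3 | exact: tens3_lin1].
Qed.

Lemma tens3_ext (M : lmodType k) (f g : T3 -> M) :
  linear f -> linear g ->
  (forall u v w, f (tens3 u v w) = g (tens3 u v w)) -> f =1 g.
Proof.
move=> lf lg fg.
pose T := {malg k[(qpath Q * qpath Q * qpath Q)%type]}.
pose F : {linear T -> M} := HB.pack f (GRing.isLinear.Build k T M *:%R f lf).
pose G : {linear T -> M} := HB.pack g (GRing.isLinear.Build k T M *:%R g lg).
apply: (@malg_lin_ext _ _ _ F G) => -[[p q] r] /=.
by have := fg (of_path k p) (of_path k q) (of_path k r); rewrite /tens3 !lextU.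
Qed.

Lemma rot3K t : rot3 (rot3 (rot3 t)) = t.
Proof.
move: t; apply: (tens3_ext (g := id)) => // [l x y|u v w].
  by rewrite !rot3_lin.
by rewrite !rot3_tens3.
Qed.

Definition outer3 (a : A) (t : T3) (b : A) : T3 :=
  lext3 (fun u v w => tens3 (a * u) v (w * b)) t.

Lemma outer3_lin a b : linear (fun t => outer3 a t b).
Proof. exact: lext3_lin. Qed.

Lemma mulr_linl (b : A) : linear (fun a : A => a * b).
Proof. by move=> l x y; rewrite mulrDl -pa_scaleAl. Qed.

Lemma mulr_linr (a : A) : linear (fun b : A => a * b).
Proof. by move=> l x y; rewrite mulrDr -pa_scaleAr. Qed.

Lemma outer3_tens3 a b u v w :
  outer3 a (tens3 u v w) b = tens3 (a * u) v (w * b).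
Proof.
apply: lext3_tens3 => x y l s t.
- by rewrite mulr_linr tens3_lin1.
- exact: tens3_lin2.
- by rewrite mulr_linl tens3_lin3.
Qed.

Lemma outer3_0 a b : outer3 a 0 b = 0.
Proof. exact: (lin0 (outer3_lin a b)). Qed.

Definition tensr (t : T2) (w : A) : T3 := sweedler (fun u v => tens3 u v w) t.

Lemma tensr_linl w : linear (tensr^~ w).
Proof. exact: sweedler_lin. Qed.

Lemma tensr_linr t : linear (tensr t).
Proof.
apply: (sweedler_linf (F := fun w u v => tens3 u v w)) => u v.
exact: tens3_lin3.
Qed.

Lemma tensr_tens2 u v w : tensr (tens2 u v) w = tens3 u v w.
Proof.
apply: sweedler_tens2 => x; [exact: tens3_lin1 | exact: tens3_lin2].
Qed.

(** The inner bimodule structure on [A (x) A]; [dder_bimod a d b c] is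
    [inner a (d c) b].  The flip exchanges it with the outer structure. *)
Definition inner (a : A) (t : T2) (b : A) : T2 :=
  sweedler (fun u v => tens2 (u * b) (a * v)) t.

Lemma inner_lin a b : linear (fun t => inner a t b).
Proof. exact: sweedler_lin. Qed.

Lemma inner_tens2 a b u v : inner a (tens2 u v) b = tens2 (u * b) (a * v).
Proof.
apply: sweedler_tens2 => x l y z.
  by rewrite mulr_linl tens2_linl.
by rewrite mulr_linr tens2_linr.
Qed.

Lemma swap_lin : linear (@swap k Q).
Proof. exact: sweedler_lin. Qed.

Lemma swap_tens2 (u v : A) : swap (tens2 u v) = tens2 v u.
Proof.
apply: (sweedler_tens2 (f := fun u v => tens2 v u)) => x;
  [exact: tens2_linr | exact: tens2_linl].
Qed.

Lemma swap_outer a b (t : T2) : swap (outer a t b) = inner a (swap t) b.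
Proof.
move: t; apply: tens2_ext => [l x y|l x y|u v].
- by rewrite outer_lin swap_lin.
- by rewrite swap_lin inner_lin.
- by rewrite outer_tens2 !swap_tens2 inner_tens2.
Qed.

(** On pure tensors, [s' (x) s'' t' (x) t'']: the shape of the cross terms that
    the Leibniz rule produces in an iterated bracket. *)
Definition glue (s t : T2) : T3 :=
  sweedler (fun x y => tensr (outer 1 s x) y) t.

Lemma glue_linl t : linear (glue^~ t).
Proof.
apply: (sweedler_linf (F := fun s x y => tensr (outer 1 s x) y)) => x y l s s'.
by rewrite outer_lin tensr_linl.
Qed.

Lemma glue_linr s : linear (glue s).
Proof. exact: sweedler_lin. Qed.

Lemma glue_tens2 s x y : glue s (tens2 x y) = tensr (outer 1 s x) y.
Proof.
apply: sweedler_tens2 => z l u v.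
  by rewrite outer_linr tensr_linl.
by rewrite tensr_linr.
Qed.

Lemma vanish_of_generators (M : lmodType k) (f : A -> M) :
  linear f -> (forall v, f (idem v) = 0) -> (forall x, f (arr x) = 0) ->
  (forall a b, f a = 0 -> f b = 0 -> f (a * b) = 0) -> forall a, f a = 0.
Proof.
move=> lf fe fa fM; apply: pa_lin_ext => // [l x y|p].
  by rewrite scaler0 addr0.
rewrite pathE; apply: (fM) => //.
elim: (arrows p) => [|x s IHs]; rewrite /word ?big_nil ?big_cons; last exact: fM.
by rewrite -[1]/(pa_one k Q) (lin_sum _ _ _ lf) big1.
Qed.

End Tensors.

(** * Reduction of the double Jacobi identity to arrows *)

Section Jacobi.
Variables (k : fieldType) (Q : quiver).

Local Notation A := (path_algebra k Q).
Local Notation T2 := (tensor2 k Q).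
Local Notation T3 := (tensor3 k Q).

Variable br : A -> A -> T2.
Hypothesis brP : double_bracket br.
Hypothesis br_idem : forall a v, br a (idem v) = 0.

Let brl b : linear (br^~ b). Proof. by case: brP. Qed.
Let brr a : linear (br a). Proof. by case: brP => _ /(_ a)[]. Qed.
Let brM a c d : br a (c * d) = outer c (br a d) 1 + outer 1 (br a c) d.
Proof. by case: brP => _ /(_ a)[]. Qed.
Let brC a b : br a b = - swap (br b a). Proof. by case: brP. Qed.

Lemma br1 a : br a 1 = 0.
Proof.
by rewrite -[1]/(pa_one k Q) (lin_sum _ _ _ (brr a)) big1.
Qed.

Lemma br_idem_l a v : br (idem v) a = 0.
Proof. by rewrite brC br_idem (lin0 (@swap_lin _ _)) oppr0. Qed.

(** The flip turns the Leibniz rule for the outer structure in the second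
    argument into one for the inner structure in the first argument. *)
Lemma brMl c d a : br (c * d) a = inner c (br d a) 1 + inner 1 (br c a) d.
Proof.
rewrite brC brM (linD (@swap_lin _ _)) !swap_outer opprD.
by rewrite -!(linN (inner_lin _ _)) -!brC.
Qed.

(** The left extension [{{a, t'}} (x) t''] of the bracket to tensors. *)
Definition nested (a : A) (t : T2) : T3 := sweedler (fun u v => tensr (br a u) v) t.

Lemma nested_lin a : linear (nested a).
Proof. exact: sweedler_lin. Qed.

Lemma nested_linl t : linear (nested^~ t).
Proof.
apply: (sweedler_linf (F := fun a u v => tensr (br a u) v)) => u v l a b.
by rewrite brl tensr_linl.
Qed.

Lemma nested_tens2 a u v : nested a (tens2 u v) = tensr (br a u) v.
Proof.
apply: sweedler_tens2 => x l y z; last by rewrite tensr_linr.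
by rewrite brr tensr_linl.
Qed.

(** The three terms of the double Jacobi identity differ by a cyclic
    permutation of the arguments followed by one of the tensor factors; this
    form makes the cyclic invariance immediate. *)
Definition jacobiator (a b c : A) : T3 :=
  nested a (br b c) + rot3 (nested b (br c a)) + rot3 (rot3 (nested c (br a b))).

Lemma double_jacobiE :
  double_jacobi br <-> forall a b c, jacobiator a b c = 0.
Proof.
suff E a b c : jacobiator a b c =
    sweedler (fun u v => sweedler (fun x y => tens3 x y v) (br a u)) (br b c)
  + sweedler (fun u v => sweedler (fun x y => tens3 v x y) (br b u)) (br c a)
  + sweedler (fun u v => sweedler (fun x y => tens3 y v x) (br c u)) (br a b).
  by split=> J a b c; have := J a b c; rewrite E.
have lr := @rot3_lin k Q.
rewrite /jacobiator /nested !(lin_sweedler _ _ lr); congr (_ + _ + _).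
  apply: eq_sweedler => u v; rewrite /tensr (lin_sweedler _ _ lr).
  by apply: eq_sweedler => x y; rewrite rot3_tens3.
apply: eq_sweedler => u v; rewrite /tensr !(lin_sweedler _ _ lr).
by apply: eq_sweedler => x y; rewrite !rot3_tens3.
Qed.

Lemma jacobiator_cyc a b c : jacobiator a b c = rot3 (jacobiator b c a).
Proof.
rewrite /jacobiator !(linD (@rot3_lin _ _)) rot3K.
by rewrite -addrA addrC.
Qed.

Lemma jacobiator_lin a b : linear (jacobiator a b).
Proof.
move=> l x y; rewrite /jacobiator brl brr !nested_lin nested_linl !rot3_lin.
by rewrite !scalerDr [RHS]addrACA [X in _ = X + _]addrACA.
Qed.

Lemma nested_outer a c t d :
  nested a (outer c t d) =
    outer3 c (nested a t) d + outer3 1 (glue (br a c) t) d.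
Proof.
move: t; apply: tens2_ext => [l x y|l x y|u v].
- by rewrite outer_lin nested_lin.
- by rewrite nested_lin glue_linr !outer3_lin scalerDr addrACA.
rewrite outer_tens2 !nested_tens2 glue_tens2 brM (linD (tensr_linl _)).
congr (_ + _).
  move: (br a u); apply: tens2_ext => [l x y|l x y|x y].
  - by rewrite outer_lin tensr_linl.
  - by rewrite tensr_linl outer3_lin.
  - by rewrite outer_tens2 !tensr_tens2 outer3_tens3 mulr1.
move: (br a c); apply: tens2_ext => [l x y|l x y|x y].
- by rewrite outer_lin tensr_linl.
- by rewrite outer_lin tensr_linl outer3_lin.
- by rewrite outer_tens2 !tensr_tens2 outer3_tens3 !mul1r.
Qed.

Lemma rot3_nested_inner b c t d :
  rot3 (nested b (inner c t d)) =
    outer3 c (rot3 (nested b t)) d + outer3 c (glue (swap t) (br b d)) 1.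
Proof.
move: t; apply: tens2_ext => [l x y|l x y|u v].
- by rewrite inner_lin nested_lin rot3_lin.
- rewrite nested_lin rot3_lin swap_lin glue_linl !outer3_lin scalerDr.
  exact: addrACA.
rewrite inner_tens2 !nested_tens2 swap_tens2 brM (linD (tensr_linl _)).
rewrite (linD (@rot3_lin _ _)) addrC; congr (_ + _).
  move: (br b u); apply: tens2_ext => [l x y|l x y|x y].
  - by rewrite outer_lin tensr_linl rot3_lin.
  - by rewrite tensr_linl rot3_lin outer3_lin.
  - by rewrite outer_tens2 !tensr_tens2 !rot3_tens3 outer3_tens3 mul1r.
move: (br b d); apply: tens2_ext => [l x y|l x y|x y].
- by rewrite outer_lin tensr_linl rot3_lin.
- by rewrite glue_linr outer3_lin.
- by rewrite glue_tens2 !outer_tens2 !tensr_tens2 rot3_tens3 outer3_tens3 mul1r.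
Qed.

Lemma rot3_rot3_nestedM c d t :
  rot3 (rot3 (nested (c * d) t)) =
    outer3 c (rot3 (rot3 (nested d t))) 1 + outer3 1 (rot3 (rot3 (nested c t))) d.
Proof.
have rrE a s b v : rot3 (rot3 (tensr (inner a s b) v)) =
    outer3 a (rot3 (rot3 (tensr s v))) b.
  move: s; apply: tens2_ext => [l x y|l x y|x y].
  - by rewrite inner_lin tensr_linl !rot3_lin.
  - by rewrite tensr_linl !rot3_lin outer3_lin.
  - by rewrite inner_tens2 !tensr_tens2 !rot3_tens3 outer3_tens3.
move: t; apply: tens2_ext => [l x y|l x y|u v].
- by rewrite nested_lin !rot3_lin.
- by rewrite !nested_lin !rot3_lin !outer3_lin scalerDr addrACA.
rewrite !nested_tens2 brMl (linD (tensr_linl _)) !(linD (@rot3_lin _ _)).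
by rewrite !rrE.
Qed.

(** The Leibniz rule produces two extra terms: one from the first summand,
    glued from [{{a, c}}] and [{{b, d}}], and one from the second, glued from
    the flip of [{{c, a}}] and [{{b, d}}].  They cancel by antisymmetry. *)
Lemma jacobiatorM a b c d :
  jacobiator a b (c * d) =
    outer3 c (jacobiator a b d) 1 + outer3 1 (jacobiator a b c) d.
Proof.
rewrite /jacobiator brM brMl rot3_rot3_nestedM !(linD (nested_lin _)).
rewrite (linD (@rot3_lin _ _)) !nested_outer !rot3_nested_inner !br1.
rewrite (lin0 (glue_linl _)) (lin0 (glue_linr _)) !outer3_0 !addr0.
have -> : swap (br c a) = - br a c by rewrite [in RHS]brC opprK.
rewrite (linN (glue_linl _)) (linN (outer3_lin _ _)).
rewrite !(linD (outer3_lin _ _)).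
set g := outer3 1 (glue _ _) 1.

rewrite [RHS]addrACA [X in _ = X + _]addrACA; congr (_ + _).
rewrite [X in X + _ = _]addrAC [X in _ + X = _]addrA [LHS]addrACA subrr.
by rewrite addr0 addrACA.
Qed.

Lemma jacobiator_idem a b v : jacobiator a b (idem v) = 0.
Proof.
rewrite /jacobiator br_idem br_idem_l !(lin0 (nested_lin _)).
rewrite (lin0 (@rot3_lin _ _)).
rewrite !add0r [nested _ _](_ : _ = 0) ?(lin0 (@rot3_lin _ _)) //.
move: (br a b); apply: (tens2_ext (g := fun=> 0)) => [||x y].
- exact: nested_lin.
- by move=> l x y; rewrite scaler0 addr0.
- by rewrite nested_tens2 br_idem_l (lin0 (tensr_linl _)).
Qed.

Lemma jacobiator_extend a b :
  (forall x, jacobiator a b (arr x) = 0) -> forall c, jacobiator a b c = 0.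
Proof.
move=> J; apply: vanish_of_generators => // [|v|c d Jc Jd].
- exact: jacobiator_lin.
- exact: jacobiator_idem.
- by rewrite jacobiatorM Jc Jd !outer3_0 addr0.
Qed.

(** The derivation property frees the last argument; a cyclic permutation then
    brings another argument to the last place. *)
Lemma double_jacobi_on_arrows :
  (forall x y z, jacobiator (arr x) (arr y) (arr z) = 0) -> double_jacobi br.
Proof.
have cyc a b c : jacobiator b c a = 0 -> jacobiator a b c = 0.
  by rewrite [jacobiator a b c]jacobiator_cyc => ->; exact: (lin0 (@rot3_lin _ _)).
move=> J; apply/double_jacobiE => a b.
apply: jacobiator_extend => z; do 2!apply: (cyc).
move: b; apply: jacobiator_extend => y; do 2!apply: (cyc).
by move: a; apply: jacobiator_extend => x; exact: J.
Qed.

End Jacobi.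

(** * The bracket of a product of double derivations *)

Section ProductBracket.
Variables (k : fieldType) (Q : quiver).

Local Notation A := (path_algebra k Q).
Local Notation T2 := (tensor2 k Q).

(** On pure tensors, [t' s'' (x) s' t'']: the bracket determined by [d D] is
    [cross (d a) (D b) - cross (D a) (d b)], so its antisymmetry is
    [swap_cross] and its Leibniz rule is [cross_outer]. *)
Definition cross (s t : T2) : T2 := sweedler (fun u v => inner u t v) s.

Lemma inner_linl t b : linear (fun a : A => inner a t b).
Proof.
apply: (sweedler_linf (F := fun (a u v : A) => tens2 (u * b) (a * v))) => u v l x y.
by rewrite mulr_linl tens2_linr.
Qed.

Lemma inner_linr a t : linear (fun b : A => inner a t b).
Proof.
apply: (sweedler_linf (F := fun (b u v : A) => tens2 (u * b) (a * v))) => u v l x y.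
by rewrite mulr_linr tens2_linl.
Qed.

Lemma cross_linl t : linear (cross^~ t).
Proof. exact: sweedler_lin. Qed.

Lemma cross_linr s : linear (cross s).
Proof.
apply: (sweedler_linf (F := fun t u v => inner u t v)) => u v; exact: inner_lin.
Qed.

Lemma cross_tens2 u v x y :
  cross (tens2 u v) (tens2 x y) = tens2 (x * v) (u * y).
Proof.
rewrite /cross sweedler_tens2 ?inner_tens2 // => z; first exact: inner_linl.
exact: inner_linr.
Qed.

Lemma swap_cross s t : swap (cross s t) = cross t s.
Proof.
move: s; apply: tens2_ext => [l x y|l x y|u v].
- by rewrite cross_linl swap_lin.
- by rewrite cross_linr.
move: t; apply: tens2_ext => [l x y|l x y|x y].
- by rewrite cross_linr swap_lin.
- by rewrite cross_linl.
- by rewrite !cross_tens2 swap_tens2.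
Qed.

Lemma inner_outer a b c d (t : T2) :
  inner a (outer c t d) b = outer c (inner a t b) d.
Proof.
move: t; apply: tens2_ext => [l x y|l x y|x y].
- by rewrite outer_lin inner_lin.
- by rewrite inner_lin outer_lin.
- by rewrite !(outer_tens2, inner_tens2) !mulrA.
Qed.

Lemma cross_outer a b s t : cross s (outer a t b) = outer a (cross s t) b.
Proof.
rewrite /cross (lin_sweedler _ _ (outer_lin a b)).
by apply: eq_sweedler => u v; rewrite inner_outer.
Qed.

Lemma partial_derivation (a : arrow Q) : double_derivation (@partial k Q a).
Proof. by split; [exact: partial_lin | exact: partialM]. Qed.

Lemma dder_bimod_derivation a b (d : A -> T2) :
  double_derivation d -> double_derivation (dder_bimod a d b).
Proof.
case=> dl dM; split=> [l x y|x y]; rewrite /dder_bimod -!/(inner _ _ _).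
  by rewrite dl inner_lin.
by rewrite dM (linD (inner_lin _ _)) !inner_outer.
Qed.

Lemma product_bracketE (d D : A -> T2) a b :
  product_bracket d D a b = cross (d a) (D b) - cross (D a) (d b).
Proof. by []. Qed.

Lemma product_bracket_double (d D : A -> T2) :
  double_derivation d -> double_derivation D ->
  double_bracket (product_bracket d D).
Proof.
move=> [dl dM] [Dl DM]; split=> [b l x y|a|a b]; rewrite ?product_bracketE.
- by rewrite dl Dl !cross_linl scalerBr opprD addrACA.
- split=> [l x y|b c]; rewrite !product_bracketE.
    by rewrite dl Dl !cross_linr scalerBr opprD addrACA.
  rewrite dM DM !(linD (cross_linr _)) !cross_outer.
  by rewrite !(linD (outer_lin _ _)) !(linN (outer_lin _ _)) opprD addrACA.
- by rewrite (linD (@swap_lin _ _)) (linN (@swap_lin _ _)) !swap_cross opprB.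
Qed.

Lemma double_bracket_sum (I : Type) (r : seq I) (P : pred I)
    (F : I -> A -> A -> T2) :
  (forall i, double_bracket (F i)) ->
  double_bracket (fun a b => \sum_(i <- r | P i) F i a b).
Proof.
move=> FP; split=> [b l x y|a|a b].
- rewrite scaler_sumr -big_split; apply: eq_bigr => i _.
  by case: (FP i) => ->.
- split=> [l x y|b c].
    rewrite scaler_sumr -big_split; apply: eq_bigr => i _.
    by case: (FP i) => _ /(_ a)[->].
  rewrite !(lin_sum _ _ _ (outer_lin _ _)) -big_split; apply: eq_bigr => i _.
  by case: (FP i) => _ /(_ a)[_ ->].
- rewrite (lin_sum _ _ _ (@swap_lin _ _)) -sumrN; apply: eq_bigr => i _.
  by case: (FP i).
Qed.

Lemma double_bracketZ l (br : A -> A -> T2) :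
  double_bracket br -> double_bracket (fun a b => l *: br a b).
Proof.
move=> [brl brd brC]; split=> [b m x y|a|a b].
- by rewrite brl scalerDr !scalerA mulrC.
- case: (brd a) => brr brM; split=> [m x y|b c].
    by rewrite brr scalerDr !scalerA mulrC.
  by rewrite brM !(linZ (outer_lin _ _)) scalerDr.
- by rewrite (linZ (@swap_lin _ _)) brC scalerN.
Qed.

End ProductBracket.

(** * Closed paths are the nonzero cyclic words *)

Section CyclicWords.
Variables (k : fieldType) (Q : quiver).

Local Notation DQ := (double_quiver Q).
Local Notation B := (path_algebra k DQ).

Lemma lin_eq_supp (M : lmodType k) (f g : B -> M) (x : B) :
  linear f -> linear g ->
  (forall p, p \in msupp x -> f (of_path k p) = g (of_path k p)) -> f x = g x.
Proof.
move=> lf lg fg.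
have xE : x = lext (@of_path k DQ) x.
  clear fg; move: x; apply: (pa_lin_ext (f := id)) => // [l x y|p].
    by rewrite linearP.
  by rewrite lextU.
rewrite xE lext.unlock (lin_sum _ _ _ lf) (lin_sum _ _ _ lg).
by apply: eq_big_seq => p px; rewrite (linZ lf) (linZ lg) fg.
Qed.

Definition stars (s : seq (arrow DQ)) : nat :=
  count (fun x : arrow Q + arrow Q => if x is inr _ then true else false) s.

Variables (a0 : arrow Q) (l0 : seq (arrow Q)).
Let w0 : seq (arrow DQ) := inl a0 :: [seq inr a | a <- l0].

(** The cyclic words here have one unstarred letter, so a rotation of [w0] has
    a normal form: rotate it until that letter comes first.  The sign is the
    one that supercommutation attaches to moving the [i] starred letters in
    front of it past the other starred letters behind it; hence [.-1], which
    discounts the unstarred letter itself. *)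
Definition cyclic_sign (s : seq (arrow DQ)) : k :=
  let i := find (@is_inl _ _) s in
  if rot i s == w0 then (-1) ^+ (i * (size s - i).-1) else 0.

Lemma stars_inl s : (stars s + count (@is_inl _ _) s)%N = size s.
Proof.
rewrite /stars addnC -(count_predC (@is_inl _ _) s); congr (_ + _)%N.
by apply: eq_count => -[].
Qed.

Lemma cyclic_sign_count s : cyclic_sign s != 0 -> count (@is_inl _ _) s = 1.
Proof.
rewrite /cyclic_sign; case: ifP => [/eqP E _|_]; last by rewrite eqxx.
have /permP <- : perm_eq w0 s by rewrite -E perm_rot.
by rewrite /= count_map; congr _.+1; rewrite (eq_count (a2 := pred0)) ?count_pred0.
Qed.

Lemma cyclic_sign_cat_inl s t :
  count (@is_inl _ _) s = 1 -> count (@is_inl _ _) t = 0 ->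
  cyclic_sign (s ++ t) = (-1) ^+ (stars s * stars t) * cyclic_sign (t ++ s).
Proof.
move=> s1 t0; have hs : has (@is_inl _ _) s by rewrite has_count s1.
have ht : has (@is_inl _ _) t = false by rewrite has_count t0.
have := stars_inl t; rewrite t0 addn0 => ->.
have := stars_inl s; rewrite s1 addn1.
rewrite /cyclic_sign !find_cat hs ht; move: hs; rewrite has_find.
set i := find _ s => lt_is ds.
have -> : rot i (s ++ t) = drop i s ++ t ++ take i s.
  by rewrite /rot drop_cat take_cat lt_is catA.
have -> : rot (size t + i) (t ++ s) = drop i s ++ t ++ take i s.
  by rewrite /rot drop_cat take_cat ltnNge leq_addr /= addKn.
case: eqP => _; last by rewrite mulr0.
rewrite !size_cat subnDl addnC -addnBA 1?ltnW // -exprD.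
have -> : stars s = (i + (size s - i).-1)%N.
  by apply: succn_inj; rewrite ds -addnS prednK ?subn_gt0 // subnKC // ltnW.
have -> : (size t + (size s - i)).-1 = (size t + (size s - i).-1)%N.
  by rewrite -(prednK (_ : 0 < size s - i)%N) ?subn_gt0 // addnS.
move: (size s - i).-1 (size t) => n m.
(* The two exponents differ by 2 n m. *)
rewrite -signr_odd -[RHS]signr_odd; congr (_ ^+ nat_of_bool _).
by rewrite !(oddD, oddM); case: (odd i); case: (odd n); case: (odd m).
Qed.

(** A word without exactly one unstarred letter is no rotation of [w0], and
    both sides vanish; otherwise that letter lies in [s] or in [t], and the
    two cases are symmetric. *)
Lemma cyclic_sign_cat s t :
  cyclic_sign (s ++ t) = (-1) ^+ (stars s * stars t) * cyclic_sign (t ++ s).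
Proof.
have [n1|] := eqVneq (count (@is_inl _ _) (s ++ t)) 1%N; last first.
  move=> n1; have z u : count (@is_inl _ _) u != 1%N -> cyclic_sign u = 0.
    by move=> h; apply/eqP; apply: contraR h => /cyclic_sign_count ->.
  by rewrite !z ?mulr0 // count_cat addnC -count_cat.
move: n1; rewrite count_cat.
case Es: (count _ s) => [|[|n]] //; first last.
  by case=> Et; rewrite (cyclic_sign_cat_inl Es Et).
rewrite add0n => Et; rewrite (cyclic_sign_cat_inl Et Es).
by rewrite [(stars t * _)%N]mulnC signrMK.
Qed.

(** Restricting to closed paths settles the products [p q] for which [q p] is
    not a path: then [p q] is not closed either. *)
Definition cyclic_functional (x : B) : k^o :=
  lext (fun p : qpath DQ =>
    (if target p == source p then cyclic_sign (arrows p) else 0) : k^o) x.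

Lemma cyclic_functional_lin : linear cyclic_functional.
Proof. by move=> l x y; rewrite /cyclic_functional linearP. Qed.

Lemma cyclic_functional_path (p q : qpath DQ) :
  cyclic_functional (of_path k p * of_path k q) =
    (-1) ^+ (star_degree p * star_degree q) *:
      cyclic_functional (of_path k q * of_path k p).
Proof.
have fl := cyclic_functional_lin.
have E (r s : qpath DQ) : cyclic_functional (of_path k r * of_path k s) =
  if (target r == source s) && (target s == source r)
  then cyclic_sign (arrows r ++ arrows s) else 0.
  rewrite -[_ * _]/(pa_mul _ _) pa_mulUU /path_mul.
  case: path_catP => [u -> e1 e2 e3|/negbTE ->] /=; last by rewrite (lin0 fl).
  by rewrite /cyclic_functional lextU e1 e2 e3 eqxx.
rewrite !E andbC; case: ifP => _; last by rewrite scaler0.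
exact: cyclic_sign_cat.
Qed.

Lemma cyclic_functional_super (x : B) :
  supercommutators x -> cyclic_functional x = 0.
Proof.
have fl := cyclic_functional_lin.
elim=> {x} [|l d e u v z hu hv _ IHz]; first exact: (lin0 fl).
rewrite fl IHz addr0 (linD fl) (linN fl) (linZ fl).
suff -> : cyclic_functional (u * v) = (-1) ^+ (d * e) *: cyclic_functional (v * u).
  by rewrite subrr scaler0.
apply: (lin_eq_supp (f := fun u => cyclic_functional (u * v))
  (g := fun u => (-1) ^+ (d * e) *: cyclic_functional (v * u))).
- by move=> m x y; rewrite mulr_linl fl.
- by move=> m x y; rewrite mulr_linr fl scalerDr !scalerA mulrC.
move=> p /hu dp.
apply: (lin_eq_supp (f := fun v => cyclic_functional (of_path k p * v))
  (g := fun v => (-1) ^+ (d * e) *: cyclic_functional (v * of_path k p))).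
- by move=> m x y; rewrite mulr_linr fl.
- by move=> m x y; rewrite mulr_linl fl scalerDr !scalerA mulrC.
by move=> q /hv dq; rewrite cyclic_functional_path dp dq.
Qed.

Lemma nonzero_nQ_closed (p : qpath DQ) :
  arrows p = w0 -> target p = source p -> nonzero_nQ (of_path k p).
Proof.
move=> pw pc /cyclic_functional_super/eqP; apply/negP.
rewrite /cyclic_functional lextU pc eqxx pw /cyclic_sign /= rot0 eqxx expr0.
exact: oner_neq0.
Qed.

End CyclicWords.

Section Nonzero.
Variables (k : fieldType) (Q : quiver).

Local Notation DQ := (double_quiver Q).
Local Notation B := (path_algebra k DQ).

Lemma word_not_path (R : quiver) v (s : seq (arrow R)) :
  ~~ is_path v s -> idem v * word k s = 0.
Proof.
elim: s v => //= x s IHs v; rewrite negb_and /word big_cons -/(word k s) mulrA.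
have [<- /= /IHs ws|xv _] := eqVneq (tail x) v.
  by rewrite idem_arr -(arr_idem k x) -mulrA ws mulr0.
rewrite -[arr x]idem_arr mulrA -[idem v * _]/(pa_mul _ _) pa_mul_ep.
by rewrite eq_sym [source _ == _](negbTE xv) !mul0r.
Qed.

Lemma homogeneous_path (p : qpath DQ) : homogeneous (star_degree p) (of_path k p).
Proof.
move=> q; rewrite /of_path basis_elt.unlock msuppU oner_eq0.
by rewrite in_fset1 => /eqP ->.
Qed.

(** If [p] does not end where it starts, then [p e = p] and [e p = 0] for the
    idempotent [e] at its end, so [p] is a supercommutator. *)
Lemma nonzero_nQ_path (p : qpath DQ) :
  nonzero_nQ (of_path k p) -> target p = source p.
Proof.
move=> nz; apply/eqP; apply: contra_notT nz => npc.
have -> : of_path k p = 1 *: (of_path k p * idem (target p) -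
    (-1) ^+ (star_degree p * star_degree (trivial_path (target p))) *:
    (idem (target p) * of_path k p)) + 0.
  rewrite path_idem addr0 scale1r -[idem _ * _]/(pa_mul _ _) pa_mul_ep.
  by rewrite (negbTE npc) scaler0 subr0.
apply: supercommutatorsD; last exact: supercommutators0; exact: homogeneous_path.
Qed.

Lemma nonzero_nQ_word a (l : seq (arrow Q)) (v := tail a)
    (w : seq (arrow DQ) := inl a :: [seq inr b | b <- l]) :
  nonzero_nQ (idem (v : vertex DQ) * word k w) <->
  is_path (v : vertex DQ) w && (last v [seq Defs.head x | x <- w] == v).
Proof.
have [wP|/word_not_path ->] := boolP (is_path (v : vertex DQ) w); last first.
  by split=> // nz; case: nz; exact: supercommutators0.
have {1}-> := esym (pathE k (QPath (path_val := (v : vertex DQ, w)) wP)).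
split=> [/nonzero_nQ_path e | /eqP e]; first exact/eqP.
exact: nonzero_nQ_closed.
Qed.

Lemma nonzero3P (a b d : arrow Q) :
  nonzero3 k a b d <->
  [/\ Defs.head a = Defs.head b, tail b = Defs.head d & tail d = tail a].
Proof.
have := nonzero_nQ_word a [:: b; d].
rewrite /word !big_cons big_nil mulr1 !mulrA.
rewrite (idem_arr k (inl _ : arrow DQ)) /= eqxx !andbT /= => E.
rewrite /nonzero3 [X in X <-> _]E.
split=> [/andP[/andP[/eqP-> /eqP->] /eqP->]|[-> -> ->]] //.
by rewrite !eqxx.
Qed.

Lemma nonzero4P (p q r s : arrow Q) :
  nonzero4 k p q r s <->
  [/\ Defs.head p = Defs.head q, tail q = Defs.head r, tail r = Defs.head s
    & tail s = tail p].
Proof.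
have := nonzero_nQ_word p [:: q; r; s].
rewrite /word !big_cons big_nil mulr1 !mulrA.
rewrite (idem_arr k (inl _ : arrow DQ)) /= eqxx !andbT /= => E.
rewrite /nonzero4 [X in X <-> _]E.
split=> [/andP[/and3P[/eqP-> /eqP-> /eqP->] /eqP->]|[-> -> -> ->]] //.
by rewrite !eqxx.
Qed.

End Nonzero.

(** * The bracket on arrows and associativity *)

Lemma collect_coefs (k : fieldType) (V : lmodType k) (I J : finType)
    (P : pred I) (R : I -> pred J) (f : I -> k) (g : J -> I -> k) (e : J -> V)
    (D : J -> {set I}) (h : J -> I -> k) :
  (forall p x, (x \in D p) = P x && R x p) ->
  (forall p x, h p x = f x * g p x) ->
  \sum_(x | P x) f x *: (\sum_(p | R x p) g p x *: e p) =
  \sum_p (\sum_(x in D p) h p x) *: e p.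
Proof.
move=> DE hE; under [LHS]eq_bigr => x _ do rewrite scaler_sumr.
rewrite (exchange_big_dep xpredT) //=; apply: eq_bigr => p _.
rewrite scaler_suml; apply: eq_big => [x|x _]; first by rewrite DE.
by rewrite hE scalerA.
Qed.

Lemma sub_collect (k : fieldType) (V : lmodType k) (J : finType)
    (f g : J -> k) (e : J -> V) :
  \sum_p f p *: e p - \sum_p g p *: e p = \sum_p (f p - g p) *: e p.
Proof. by rewrite -sumrB; apply: eq_bigr => p _; rewrite scalerBl. Qed.

Section Linear.
Variables (k : fieldType) (Q : quiver).
Variable c : arrow Q -> arrow Q -> arrow Q -> k.

Local Notation A := (path_algebra k Q).
Local Notation T2 := (tensor2 k Q).
Local Notation T3 := (tensor3 k Q).
Local Notation N a b d := (`[< nonzero3 k a b d >]).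

Lemma lin_bracket_double : double_bracket (lin_bracket c).
Proof.
apply: double_bracket_sum => a; apply: double_bracket_sum => b.
apply: double_bracket_sum => d; apply: double_bracketZ.
apply: product_bracket_double; last exact: partial_derivation.
exact/dder_bimod_derivation/partial_derivation.
Qed.

Lemma lin_bracket_idem u v : lin_bracket c u (idem v) = 0.
Proof.
rewrite /lin_bracket big1 // => a _; rewrite big1 // => b _; rewrite big1 // => d _.
rewrite product_bracketE /dder_bimod !partial_idem -!/(inner _ _ _).
by rewrite (lin0 (inner_lin _ _)) !(lin0 (cross_linr _)) subrr scaler0.
Qed.

(** [N a u v] says that [a] runs parallel to the path [v u], so this is a product
    on the span of the arrows that respects their ends; [mul_right] and
    [mul_left] below are [u.(v.w)] and [(u.v).w]. *)
Definition arrow_mul (u v : arrow Q) : A := \sum_(a | N a u v) c a u v *: arr a.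

Lemma product_bracket_arr (a b d u v : arrow Q) : nonzero3 k a b d ->
  product_bracket (dder_bimod (arr a) (partial b) 1) (partial d) (arr u) (arr v) =
    (if (b == u) && (d == v) then tens2 (arr a) (idem (tail u)) else 0) -
    (if (b == v) && (d == u) then tens2 (idem (tail v)) (arr a) else 0) :> T2.
Proof.
move=> /nonzero3P[hab tbd tda].
rewrite product_bracketE /dder_bimod !partial_arr -!/(inner _ _ _) /partial_arrow.
have ib (x : arrow Q) : inner (arr a)
   (if x == b then tens2 (idem (tail b)) (idem (Defs.head b)) else 0) 1 =
   if b == x then tens2 (idem (tail b)) (arr a) else 0 :> T2.
  rewrite eq_sym; case: ifP => _; last exact: (lin0 (inner_lin _ _)).
  by rewrite inner_tens2 mulr1 -hab arr_idem.
rewrite !ib [v == d]eq_sym [u == d]eq_sym; congr (_ - _).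
- case: eqP => [<-|_] /=; last exact: (lin0 (cross_linl _)).
  case: eqP => [_|_] /=; last exact: (lin0 (cross_linr _)).
  by rewrite cross_tens2 tda idem_arr tbd idem_idem.
- rewrite andbC; case: (d =P u) => [_|_] /=; last exact: (lin0 (cross_linl _)).
  case: eqP => [<-|_] /=; last exact: (lin0 (cross_linr _)).
  by rewrite cross_tens2 tda tbd idem_idem idem_arr.
Qed.

Lemma lin_bracket_arr u v :
  lin_bracket c (arr u) (arr v) =
    tens2 (arrow_mul u v) (idem (tail u)) - tens2 (idem (tail v)) (arrow_mul v u).
Proof.
have pick a (X : T2) s t :
    \sum_b \sum_(d | N a b d) c a b d *: (if (b == s) && (d == t) then X else 0) =
    if N a s t then c a s t *: X else 0.
  rewrite (bigD1 s) //= [X in _ + X]big1 ?addr0 => [|b /negbTE bs]; last first.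
    by rewrite big1 // => d _; rewrite bs scaler0.
  rewrite eqxx big_mkcond (bigD1 t) //= eqxx big1 ?addr0 // => d /negbTE dt.
  by rewrite dt scaler0 if_same.
rewrite /arrow_mul (lin_sum _ _ _ (tens2_linl _)) (lin_sum _ _ _ (tens2_linr _)).
rewrite [X in _ = X - _]big_mkcond [X in _ = _ - X]big_mkcond -sumrB.
apply: eq_bigr => a _.
transitivity (
  \sum_b \sum_(d | N a b d) c a b d *:
     (if (b == u) && (d == v) then tens2 (arr a) (idem (tail u)) else 0 : T2) -
  \sum_b \sum_(d | N a b d) c a b d *:
     (if (b == v) && (d == u) then tens2 (idem (tail v)) (arr a) else 0 : T2)).
  rewrite -sumrB; apply: eq_bigr => b _.
  rewrite -sumrB; apply: eq_bigr => d /asboolP nz.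
  by rewrite product_bracket_arr // scalerBr.
congr (_ - _).
- rewrite (pick a (tens2 (arr a) (idem (tail u))) u v); case: ifP => // _.
  by rewrite (linZ (tens2_linl (idem (tail u)))).
- rewrite (pick a (tens2 (idem (tail v)) (arr a)) v u); case: ifP => // _.
  by rewrite (linZ (tens2_linr (idem (tail v)))).
Qed.

Definition mul_right (u v w : arrow Q) : A :=
  \sum_(x | N x v w) c x v w *: arrow_mul u x.

Definition mul_left (u v w : arrow Q) : A :=
  \sum_(y | N y u v) c y u v *: arrow_mul y w.

Definition associator u v w := mul_right u v w - mul_left u v w.

(** The condition [N x v w] forces the tails of [x] and [w] to agree, which is
    why the idempotent can be taken out of the sum over [x]. *)
Lemma lin_bracket_mul u v w :
  lin_bracket c (arr u) (arrow_mul v w) =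
    tens2 (mul_right u v w) (idem (tail u)) - tens2 (idem (tail w)) (mul_left v w u).
Proof.
have [_ /(_ (arr u))[brr _] _] := lin_bracket_double.
rewrite (lin_sum _ _ _ brr) /mul_right /mul_left.
rewrite (lin_sum _ _ _ (tens2_linl _)) (lin_sum _ _ _ (tens2_linr _)) -sumrB.
apply: eq_bigr => x /asboolP /nonzero3P[_ _ tw].
rewrite (linZ brr) (linZ (tens2_linl _)) (linZ (tens2_linr _)) -scalerBr.
by rewrite lin_bracket_arr tw.
Qed.

Lemma nested_arr u v w :
  nested (lin_bracket c) (arr u) (lin_bracket c (arr v) (arr w)) =
    tens3 (mul_right u v w) (idem (tail u)) (idem (tail v)) -
    tens3 (idem (tail w)) (mul_left v w u) (idem (tail v)).
Proof.
have nt x y : nested (lin_bracket c) (arr u) (tens2 x y) =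
    tensr (lin_bracket c (arr u) x) y.
  by apply: nested_tens2; exact: lin_bracket_double.
rewrite [lin_bracket c (arr v) _]lin_bracket_arr (linD (nested_lin _ _)).
rewrite (linN (nested_lin _ _)) !nt lin_bracket_idem lin_bracket_mul.
rewrite (lin0 (tensr_linl _)) subr0 (linD (tensr_linl _)) (linN (tensr_linl _)).
by rewrite !tensr_tens2.
Qed.

Lemma jacobiator_arr u v w :
  jacobiator (lin_bracket c) (arr u) (arr v) (arr w) =
    tens3 (associator u v w) (idem (tail u)) (idem (tail v)) +
    tens3 (idem (tail w)) (associator v w u) (idem (tail v)) +
    tens3 (idem (tail w)) (idem (tail u)) (associator w u v).
Proof.
rewrite /jacobiator !nested_arr /associator.
move: (mul_right u v w) (mul_right v w u) (mul_right w u v).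
move: (mul_left u v w) (mul_left v w u) (mul_left w u v).
move: (idem (tail u)) (idem (tail v)) (idem (tail w)) => a b d x' y' z' x y z.
rewrite !(linD (@rot3_lin _ _)) !(linN (@rot3_lin _ _)) !rot3_tens3.
rewrite (linD (tens3_lin1 _ _)) (linN (tens3_lin1 _ _)).
rewrite (linD (tens3_lin2 _ _)) (linN (tens3_lin2 _ _)).
rewrite (linD (tens3_lin3 _ _)) (linN (tens3_lin3 _ _)).
rewrite [X in X + _ = _]addrACA [LHS]addrACA [X in _ = X + _]addrACA [RHS]addrACA.
by congr (_ + _); rewrite -[RHS]addrA [RHS]addrC.
Qed.

Definition assoc_coef (p q r s : arrow Q) : k :=
  \sum_(x in arrows_p_q_rs k p q r s) c x r s * c p q x
  - \sum_(y in arrows_qr_p_s k q r p s) c p y s * c y q r.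

(** The index sets of the theorem collect the intermediate arrows through which
    [p] occurs in the two bracketings. *)
Lemma associatorE q r s :
  associator q r s = \sum_p assoc_coef p q r s *: arr p.
Proof.
have setE (X Y : Prop) : `[< X /\ Y >] = `[< X >] && `[< Y >].
  by apply/asboolP/andP => -[/asboolP ? /asboolP ?].
have ER : mul_right q r s =
    \sum_p (\sum_(x in arrows_p_q_rs k p q r s) c x r s * c p q x) *: arr p.
  by apply: collect_coefs => p x //; rewrite inE setE.
have EL : mul_left q r s =
    \sum_p (\sum_(y in arrows_qr_p_s k q r p s) c p y s * c y q r) *: arr p.
  apply: collect_coefs => p y; last exact: mulrC.
  by rewrite inE setE.
rewrite /associator ER EL.
exact: sub_collect.
Qed.

(** An arrow [x] in either index set would close [p q^* r^* s^*] up. *)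
Lemma assoc_coef0 p q r s : ~ nonzero4 k p q r s -> assoc_coef p q r s = 0.
Proof.
move=> nz; rewrite /assoc_coef !big1 ?subrr // => x; rewrite inE => /asboolP[].
  move=> /nonzero3P[h1 h2 h3] /nonzero3P[h4 h5 h6]; case: nz; apply/nonzero4P.
  by split; congruence.
move=> /nonzero3P[h1 h2 h3] /nonzero3P[h4 h5 h6]; case: nz; apply/nonzero4P.
by split; congruence.
Qed.

Lemma mcoeff_tens3 (u v w : A) p q r :
  (tens3 u v w : {malg k[_]})@_(p, q, r) =
  (u : {malg k[_]})@_p * (v : {malg k[_]})@_q * (w : {malg k[_]})@_r.
Proof.
pose co (X : choiceType) (i : X) (t : {malg k[X]}) : k^o := t@_i.
have col X i : linear (@co X i) by move=> l x y; rewrite /co mcoeffD mcoeffZ.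
have colE X i l x y : @co X i (l *: x + y) = l * co X i x + co X i y.
  exact: col.
rewrite -[RHS]/(co _ p u * co _ q v * co _ r w : k^o) -[LHS]/(co _ (p, q, r) _).
apply: (pa_lin_ext (f := fun u => co _ (p, q, r) (tens3 u v w))
  (g := fun u => co _ p u * co _ q v * co _ r w : k^o)) => [l x y|l x y|p'].
- by rewrite tens3_lin1 col.
- by rewrite colE -[RHS]/(l * _ + _) !mulrDl !mulrA.
apply: (pa_lin_ext (f := fun v => co _ (p, q, r) (tens3 _ v w))
  (g := fun v => co _ p _ * co _ q v * co _ r w : k^o)) => [l x y|l x y|q'].
- by rewrite tens3_lin2 col.
- by rewrite colE -[RHS]/(l * _ + _) mulrDr mulrDl mulrCA !mulrA.
apply: (pa_lin_ext (f := fun w => co _ (p, q, r) (tens3 _ _ w))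
  (g := fun w => co _ p _ * co _ q _ * co _ r w : k^o)) => [l x y|l x y|r'].
- by rewrite tens3_lin3 col.
- by rewrite colE -[RHS]/(l * _ + _) mulrDr mulrCA.
rewrite /tens3 /of_path !lextU /co basis_elt.unlock !mcoeffU.
by rewrite -!natrM !mulnb.
Qed.

Lemma mcoeff_arr (a b : arrow Q) :
  (arr a : {malg k[_]})@_(arrow_path b) = (a == b)%:R.
Proof.
rewrite /arr /of_path basis_elt.unlock mcoeffU; congr (nat_of_bool _)%:R.
by apply/eqP/eqP => [/(congr1 (@arrows _)) [] | ->].
Qed.

Lemma mcoeff_idem_arrow (v : vertex Q) (b : arrow Q) :
  (idem v : {malg k[_]})@_(arrow_path b) = 0.
Proof.
by rewrite /idem /of_path basis_elt.unlock mcoeffU; case: eqP.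
Qed.

Lemma mcoeff_idem (v : vertex Q) : ((idem v : A) : {malg k[_]})@_(trivial_path v) = 1.
Proof. by rewrite /idem /of_path basis_elt.unlock mcoeffU eqxx. Qed.

Lemma mcoeff_associator p q r s :
  (associator q r s : {malg k[_]})@_(arrow_path p) = assoc_coef p q r s.
Proof.
pose co (t : A) : k^o := (t : {malg k[_]})@_(arrow_path p).
have col : linear co by move=> l x y; rewrite /co mcoeffD mcoeffZ.
rewrite -[LHS]/(co _) associatorE (lin_sum _ _ _ col).
transitivity (\sum_x assoc_coef x q r s * (x == p)%:R).
  by apply: eq_bigr => x _; rewrite (linZ col) -mcoeff_arr.
rewrite (bigD1 p) //= eqxx mulr1 big1 ?addr0 // => x /negbTE ->.
exact: mulr0.
Qed.

(** Reads off the first of three summands shaped like those of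
    [jacobiator_arr]: the other two have a trivial path as first factor. *)
Lemma mcoeff_first (x y z : A) (u v w : vertex Q) (p : arrow Q) :
  (tens3 x (idem u) (idem v) + tens3 (idem w) y (idem v)
     + tens3 (idem w) (idem u) z : {malg k[_]})
    @_(arrow_path p, trivial_path u, trivial_path v) =
  (x : {malg k[_]})@_(arrow_path p).
Proof.
rewrite mcoeffD mcoeffD !mcoeff_tens3 (mcoeff_idem u) (mcoeff_idem v).
by rewrite (mcoeff_idem_arrow w p) !mulr1 !mul0r !addr0.
Qed.

Lemma lin_bracket_poisson :
  double_poisson (lin_bracket c) <-> forall p q r s, assoc_coef p q r s = 0.
Proof.
split=> [[_ /double_jacobiE J] p q r s | E].
  rewrite -mcoeff_associator -(mcoeff_first _ (associator r s q)
    (associator s q r) (tail q) (tail r) (tail s)).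
  by rewrite -jacobiator_arr J mcoeff0.
split; first exact: lin_bracket_double.
apply: double_jacobi_on_arrows => [||x y z]; first exact: lin_bracket_double.
  exact: lin_bracket_idem.
have a0 u v w : associator u v w = 0.
  by rewrite associatorE big1 // => p _; rewrite E scale0r.
rewrite jacobiator_arr !a0 (lin0 (tens3_lin1 _ _)) (lin0 (tens3_lin2 _ _)).
by rewrite (lin0 (tens3_lin3 _ _)) !addr0.
Qed.

End Linear.

Theorem theorem2 (k : closedFieldType) (hk : [pchar k] =i pred0) (Q : quiver)
    (c : arrow Q -> arrow Q -> arrow Q -> k) :
  double_poisson (lin_bracket c) <->
  (forall p q r s : arrow Q, nonzero4 k p q r s ->
     \sum_(x in arrows_p_q_rs k p q r s) c x r s * c p q x
     - \sum_(y in arrows_qr_p_s k q r p s) c p y s * c y q r = 0).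
Proof.
rewrite lin_bracket_poisson; split=> E p q r s; first by move=> _; exact: E.
by have [/E|/assoc_coef0] := pselect (nonzero4 k p q r s).
Qed.
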